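(* Let $n\ge 1$ and let $(x_1,y_1),\dots,(x_n,y_n)$ be a sample from the FGM bivariate exponential distribution with association parameter $\theta$, such that $(2e^{-x_i}-1)(2e^{-y_i}-1)\neq 0$ for every $i$, and let $c_1,\dots,c_n$ be defined by $\frac{1}{c_i}=(2e^{-x_i}-1)(2e^{-y_i}-1)$. Suppose that there are exactly $p$ distinct values among $c_1,\dots,c_n$, and that these distinct values occur with multiplicities $n_1,\dots,n_p$ in the list $c_1,\dots,c_n$ ($1\le n_i\le n$). Suppose that exactly $l$ of the multiplicities $n_1,\dots,n_p$ are greater than $1$, and let $m\le n$ be the sum of these $l$ multiplicities (with $m=0$ if $l=0$). Exclude the case $l=1$, $m=n$ (in which $n\geq 2$ and all $c_i$ are the same). Then the ML-degree of the association parameter $\theta$ in the FGM bivariate exponential distribution is $n+l-m-1$.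
   Context: The Farlie-Gumbel-Morgenstern (FGM) bivariate exponential distribution with association parameter $\theta\in[-1,1]$ has density $f(x,y)=e^{-(x+y)}\left[1+\theta(2e^{-x}-1)(2e^{-y}-1)\right]$ for $(x,y)$ in the first quadrant of $\mathbb{R}^2$ ($x,y\ge 0$). For a sample $(x_1,y_1),\dots,(x_n,y_n)$, the log-likelihood (up to an additive constant) is $\ell(\theta)=\sum_{i=1}^n\log\left(1+\theta(2e^{-x_i}-1)(2e^{-y_i}-1)\right)$, and the score equation is $$\sum_{i=1}^n\frac{(2e^{-x_i}-1)(2e^{-y_i}-1)}{1+\theta(2e^{-x_i}-1)(2e^{-y_i}-1)}=0 ,$$ which, with $\frac1{c_i}=(2e^{-x_i}-1)(2e^{-y_i}-1)$, is rewritten as $\sum_{i=1}^n\frac{1}{c_i+\theta}=0$. The ML-degree (maximum likelihood degree) of $\theta$ is the number of solutions $\theta\in\mathbb{C}$ of the score equation, counted with multiplicity. Explicitly, write the left side as $h(\theta)/k(\theta)$ with $h(\theta)=\sum_{i=1}^n\prod_{j=1,\,j\neq i}^n(\theta+c_j)$ and $k(\theta)=\prod_{i=1}^n(\theta+c_i)$ (an empty product is $1$). The solutions of the score equation are the complex zeros of $h$ that are not zeros of $k$, each counted with its multiplicity as a zero of $h$. *)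

(* Defs.v *)
From HB Require Import structures.
From mathcomp Require Import all_boot all_order all_algebra.
From mathcomp Require Import all_classical all_reals all_analysis.
From mathcomp Require Import complex.
From mathcomp Require Import ring lra.
Set Implicit Arguments.
Unset Strict Implicit.
Unset Printing Implicit Defensive.
Import Order.TTheory GRing.Theory Num.Theory.
Import numFieldNormedType.Exports.
Local Open Scope classical_set_scope.
Local Open Scope ring_scope.
Local Open Scope complex_scope.

Section FGM.
Variable R : realType.

Definition fgm_weight (x y : R) : R :=
  (2 * expR (- x) - 1) * (2 * expR (- y) - 1).

Definition fgm_density (theta x y : R) : R :=
  if (0 <= x) && (0 <= y)
  then expR (- (x + y)) * (1 + theta * fgm_weight x y) else 0.

(* The possible observations of the distribution; for theta in [-1, 1] this
   is the closed first quadrant, see fgm_supportE. *)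
Definition fgm_support (theta : R) : set (R * R) :=
  closure [set u | 0 < fgm_density theta u.1 u.2].

Lemma fgm_supportE (theta : R) : -1 <= theta <= 1 ->
  fgm_support theta = [set u | 0 <= u.1 /\ 0 <= u.2].
Proof.
move=> theta1; apply/seteqP; split=> [[a b]|[a b] /= [a0 b0]].
  have cl : closed ([set u | 0 <= u.1 /\ 0 <= u.2] : set (R * R)).
    apply: closedI.
      apply: (closed_comp (f := fst) (D := [set t : R | 0 <= t])).
        by move=> ? _; exact: cvg_fst.
      exact: closed_ge.
    apply: (closed_comp (f := snd) (D := [set t : R | 0 <= t])).
      by move=> ? _; exact: cvg_snd.
    exact: closed_ge.
  move=> h; rewrite [X in X (a, b)](closure_id _).1//.
  apply: closure_subset h => -[u v] /=.
  rewrite /fgm_density; case: ifPn => [/andP[//]|_]; last by rewrite ltxx.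
have half (t : R) : 0 < t -> `|2 * expR (- t) - 1| < 1.
  move=> t0; have := expR_gt0 (- t).
  have : expR (- t) < 1 by rewrite expR_lt1 oppr_lt0.
  by rewrite ltr_norml; lra.
have pos (s t : R) : 0 < s -> 0 < t -> 0 < fgm_density theta s t.
  move=> s0 t0; rewrite /fgm_density !ltW//= mulr_gt0 ?expR_gt0//.
  have : `|theta * fgm_weight s t| < 1.
    rewrite normrM (le_lt_trans (y := `|fgm_weight s t|))//.
      by rewrite ler_piMl// ler_norml.
    by rewrite normrM mulr_ilt1// half.
  by rewrite ltr_norml => /andP[]; lra.
move=> U /nbhs_ballP[e /= e0 eU].
exists (a + e / 2, b + e / 2); split=> /=.
  by apply: pos; lra.
apply: eU; split => /=; rewrite /ball /= opprD addrA subrr sub0r normrN.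
  by rewrite gtr0_norm; lra.
by rewrite gtr0_norm; lra.
Qed.

Section Sample.
Variables (n : nat) (x y : 'I_n -> R).

Definition fgm_loglik (theta : R) : R :=
  \sum_(i < n) ln (fgm_density theta (x i) (y i)).

Definition fgm_score (z : R[i]) : R[i] :=
  \sum_(i < n) (fgm_weight (x i) (y i))%:C
               / (1 + z * (fgm_weight (x i) (y i))%:C).

Definition fgm_c (i : 'I_n) : R := (fgm_weight (x i) (y i))^-1.

(* Unsimplified numerator and denominator of \sum_i 1 / (c_i + 'X): common
   factors are kept, so a zero of score_num that is also a zero of score_den
   is not a solution of the score equation. *)
Definition score_num : {poly R[i]} :=
  \sum_(i < n) \prod_(j < n | j != i) ('X + ((fgm_c j)%:C)%:P).

Definition score_den : {poly R[i]} :=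
  \prod_(i < n) ('X + ((fgm_c i)%:C)%:P).

Definition score_solutions : set R[i] :=
  [set z | root score_num z /\ ~~ root score_den z].

(* A sum with infinite support would be 0 by convention; this does not occur
   for n > 0, see finite_score_solutions. *)
Definition ml_degree : nat :=
  \sum_(z \in score_solutions) mup z score_num.

Lemma is_derive_fgm_loglik (theta : R) :
  (forall i, 0 <= x i) -> (forall i, 0 <= y i) ->
  (forall i, 0 < 1 + theta * fgm_weight (x i) (y i)) ->
  is_derive theta (1 : R) fgm_loglik
    (\sum_(i < n) fgm_weight (x i) (y i)
                  / (1 + theta * fgm_weight (x i) (y i))).
Proof.
move=> x0 y0 pos.
have -> : fgm_loglik = \sum_(i < n) (fun t => ln (fgm_density t (x i) (y i))).
  by apply/funext => t; rewrite fct_sumE.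
apply: is_derive_sum => i.
set w := fgm_weight _ _; set e := expR (- (x i + y i)).
have -> : (fun t => ln (fgm_density t (x i) (y i))) =
    @ln R \o (cst e + (e * w) *: id).
  apply/funext => t /=; rewrite /fgm_density x0 y0 /= -/w -/e.
  by congr ln; rewrite !fctE /= /GRing.scale /=; ring.
have e0 : 0 < e by exact: expR_gt0.
have w0 : 0 < 1 + theta * w := pos i.
have -> : w / (1 + theta * w) = ((cst e + (e * w) *: id : R -> R) theta)^-1 * (e * w).
  rewrite !fctE /= /GRing.scale /=.
  have -> : e + e * w * theta = e * (1 + theta * w) by ring.
  rewrite invfM; transitivity (e / e * (w / (1 + theta * w))); last by ring.
  by rewrite divff ?mul1r// gt_eqF.
have dg : is_derive theta (1 : R) (cst e + (e * w) *: id) (e * w).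
  apply: is_derive_eq.
  by rewrite add0r /GRing.scale /= mulr1.
apply: is_derive1_comp.
apply: is_derive1_ln; rewrite !fctE /= /GRing.scale /=.
have -> : e + e * w * theta = e * (1 + theta * w) by ring.
exact: mulr_gt0.
Qed.

Lemma score_num_horner (z : R[i]) : score_num.[z] =
  \sum_(i < n) \prod_(j < n | j != i) (z + (fgm_c j)%:C).
Proof.
rewrite /score_num horner_sum; apply: eq_bigr => i _.
by rewrite horner_prod; apply: eq_bigr => j _; rewrite !hornerE.
Qed.

Lemma score_den_horner (z : R[i]) :
  score_den.[z] = \prod_(i < n) (z + (fgm_c i)%:C).
Proof. by rewrite horner_prod; apply: eq_bigr => j _; rewrite !hornerE. Qed.

Lemma score_solutionsE :
  (forall i, fgm_weight (x i) (y i) != 0) ->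
  score_solutions =
  [set z | (forall i, 1 + z * (fgm_weight (x i) (y i))%:C != 0)
           /\ fgm_score z = 0].
Proof.
move=> w0; apply/seteqP.
have wC i : (fgm_weight (x i) (y i))%:C != 0 :> R[i].
  by rewrite (fmorph_eq0 (real_complex R)).
have fac z i : 1 + z * (fgm_weight (x i) (y i))%:C =
    (fgm_weight (x i) (y i))%:C * (z + (fgm_c i)%:C).
  by rewrite /fgm_c (fmorphV (real_complex R)) mulrDr divff// addrC mulrC.
have nz z : ~~ root score_den z <->
    (forall i, 1 + z * (fgm_weight (x i) (y i))%:C != 0).
  rewrite rootE score_den_horner prodf_seq_neq0; split.
    move=> /allP h i; rewrite fac mulf_neq0//.
    by have := h i; rewrite mem_index_enum; apply.
  move=> h; apply/allP => i _ /=; have := h i.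
  by rewrite -?fac => hi; apply: contraNneq hi => hi0; rewrite fac hi0 mulr0.
have key z : ~~ root score_den z -> score_num.[z] = score_den.[z] * fgm_score z.
  move=> hz; have := hz; rewrite nz => h1.
  rewrite score_num_horner score_den_horner /fgm_score mulr_sumr.
  apply: eq_bigr => i _; rewrite [X in _ = X * _](bigD1 i)//= fac.
  have zc : z + (fgm_c i)%:C != 0.
    by apply: contraNneq (h1 i) => hi0; rewrite fac hi0 mulr0.
  by rewrite invfM mulVKf // mulrAC divff// mul1r.
split=> z /= [].
  move=> h hz; split; first exact/nz.
  move: h; rewrite rootE key// mulf_eq0 => /orP[/eqP h|/eqP//].
  by move: hz; rewrite rootE h eqxx.
move=> /nz hz s0; split => //.
by rewrite rootE key// s0 mulr0.
Qed.

Lemma score_num_neq0 : (0 < n)%N -> score_num != 0.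
Proof.
move=> n0.
have prodE (i : 'I_n) :
    \prod_(j < n | j != i) ('X + ((fgm_c j)%:C)%:P) =
    \prod_(j <- seq.filter (predC1 i) (index_enum 'I_n))
      ('X - (- (fgm_c j)%:C)%:P) :> {poly R[i]}.
  by rewrite big_filter; apply: eq_bigr => j _; rewrite polyCN opprK.
have coef (i : 'I_n) :
    (\prod_(j < n | j != i) ('X + ((fgm_c j)%:C)%:P) : {poly R[i]})`_n.-1 = 1.
  rewrite prodE; set p := \prod_(_ <- _) _.
  have /monicP <- : p \is monic by apply: monic_prod_XsubC.
  have -> : n.-1 = (size p).-1; last by [].
  rewrite size_prod_XsubC /= -[in LHS](card_ord n) -(cardC1 i).
  by rewrite cardE bigop.deprecated_filter_index_enum.
apply/eqP => /(congr1 (fun p : {poly R[i]} => p`_n.-1)).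
rewrite coef_sum coef0 (eq_bigr (fun=> 1)) => [|i _]; last exact: coef.
rewrite sumr_const card_ord => /eqP; rewrite pnatr_eq0.
by rewrite -leqn0 leqNgt n0.
Qed.

Lemma finite_score_solutions : (0 < n)%N -> finite_set score_solutions.
Proof.
move=> n0; have h0 := score_num_neq0 n0.
have [r hr] := closed_field_poly_normal score_num.
apply: (@sub_finite_set _ _ [set` r]) => [z [hz _]|]; last exact: finite_seq.
move: hz; rewrite hr /= rootZ ?root_prod_XsubC//.
by rewrite lead_coef_eq0.
Qed.

End Sample.
End FGM.

(* Main.v *)
Require Import Defs.
From mathcomp Require Import all_boot all_order all_algebra.
From mathcomp Require Import all_classical all_reals all_analysis.
From mathcomp Require Import complex zify.
Import Order.TTheory GRing.Theory Num.Theory.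
Local Open Scope ring_scope.

(* The numerator h of the score equation is the derivative of its denominator
   k = \prod_i ('X + c_i).  In characteristic 0 a zero of k of multiplicity r is
   a zero of k' of multiplicity r - 1, so the zeros of k account for n - p of
   the n - 1 zeros of h, where p is the number of distinct c_i.  The ML-degree
   is therefore p - 1, and p = n + l - m because n - m = p - l counts the values
   that occur exactly once. *)

(** In characteristic 0 differentiation multiplies the leading coefficient by a nonzero integer. The
    truncated [.-1] covers constants and 0. *)
Lemma size_deriv_num (F : numDomainType) (q : {poly F}) :
  size q^`() = (size q).-1.
Proof.
have [->|q0] := eqVneq q 0; first by rewrite deriv0 size_poly0.
apply/eqP; rewrite eqn_leq; apply/andP; split.
  by rewrite -ltnS prednK ?lt_size_deriv// lt0n size_poly_eq0.
case s: (size q) => [//|[//|k]] /=.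
rewrite ltnNge; apply: contraNN q0 => /leq_sizeP/(_ k (leqnn k))/eqP.
by rewrite coef_deriv mulrn_eq0 /= -lead_coef_eq0 lead_coefE s.
Qed.

(** Write q = g * ('X - z)^r with g(z) nonzero and r > 0. Then q' is ('X - z)^(r-1) times a cofactor
    whose value at z is r * g(z), nonzero in characteristic 0. *)
Lemma mup_deriv (F : numFieldType) (q : {poly F}) (z : F) :
  q != 0 -> root q z -> mup z q = (mup z q^`()).+1.
Proof.
move=> q0 qz.
have [r [g]] := multiplicity_XsubC q z; rewrite q0 /= => gz qE.
have r0 : (0 < r)%N.
  by case: r qE gz => // qE; move: qz; rewrite qE expr0 mulr1 => ->.
have Er : ('X - z%:P) ^+ r = ('X - z%:P) * ('X - z%:P) ^+ r.-1.
  by rewrite -exprS prednK.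
have -> : q^`() = (g^`() * ('X - z%:P) + g *+ r) * ('X - z%:P) ^+ r.-1.
  rewrite qE derivM deriv_exp derivXsubC mul1r Er [RHS]mulrDl mulrA.
  by rewrite mulrnAr mulrnAl.
rewrite qE !mupMr// ?mup_XsubCX ?eqxx ?prednK//.
rewrite rootE !hornerE subrr mulr0 add0r hornerMn mulrn_eq0.
by rewrite -rootE (negPf gz) orbF -lt0n.
Qed.

(** Uniqueness of [s] ensures that the condition [j != i] removes exactly one factor; in the
    inductive step it is vacuous on the tail for the head index [a]. *)
Lemma deriv_prod_uniq (F : comNzRingType) (I : eqType) (s : seq I)
    (f : I -> {poly F}) : uniq s ->
  (\prod_(i <- s) f i)^`() =
  \sum_(i <- s) (f i)^`() * \prod_(j <- s | j != i) f j.
Proof.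
elim: s => [|a s IH] /=; first by rewrite !big_nil -polyC1 derivC.
move=> /andP[sa us]; rewrite !big_cons derivM IH// eqxx /=; congr (_ + _).
  congr (_ * _); rewrite [RHS]big_seq_cond [LHS]big_seq; apply: eq_bigl => i.
  by case: (boolP (i \in s)) => //= si; apply/esym/(memPn sa).
rewrite mulr_sumr [LHS]big_seq [RHS]big_seq; apply: eq_bigr => i si.
by rewrite big_cons eq_sym (memPn sa i si) mulrCA.
Qed.

(** Double counting: after exchanging the sums, each entry of [s] is met exactly once in [t]. *)
Lemma sum_count_mem (T : eqType) (s t : seq T) : uniq t -> {subset s <= t} ->
  (\sum_(z <- t) count_mem z s = size s)%N.
Proof.
move=> ut st.
under eq_bigr do rewrite -sum1_count big_mkcond /=.
rewrite exchange_big /= -[RHS]sum1_size [LHS]big_seq [RHS]big_seq.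
apply: eq_bigr => z /st zt; rewrite -big_mkcond /= sum1_count.
rewrite (eq_count (a2 := pred1 z)) => [|i /=]; last exact: eq_sym.
by rewrite count_uniq_mem// zt.
Qed.

Lemma sum_mup_deriv_prod_XsubC (F : numClosedFieldType) (s : seq F)
    (q := \prod_(a <- s) ('X - a%:P)) : (0 < size s)%N ->
  exists t : seq F, [/\ uniq t, (forall z, root q^`() z -> z \in t) &
    (\sum_(z <- t | ~~ root q z) mup z q^`() = (size (undup s)).-1)%N].
Proof.
move=> s_gt0; have q0 : q != 0 by rewrite monic_neq0// monic_prod_XsubC.
have szq : size q^`() = size s by rewrite size_deriv_num size_prod_XsubC.
have q'0 : q^`() != 0 by rewrite -size_poly_eq0 szq -lt0n.
have [r q'E] := closed_field_poly_normal q^`().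
have lc0 : lead_coef q^`() != 0 by rewrite lead_coef_eq0.
have mu z : mup z q^`() = count_mem z r.
  by rewrite q'E -mul_polyC mupMr ?mu_prod_XsubC// rootC.
have szr : (size r).+1 = size s.
  by rewrite -szq q'E size_scale// size_prod_XsubC.
have rootq z : root q z = (z \in s) by rewrite root_prod_XsubC.
(* The roots of q are included as well, so that the multiplicities in q and in q' can both be
   totalled over the same list. *)
exists (undup (s ++ r)); split; first exact: undup_uniq.
  move=> z; rewrite mem_undup mem_cat q'E rootZ//.
  by rewrite root_prod_XsubC => ->; rewrite orbT.
set t := undup _.
have st : {subset s <= t} by move=> z zs; rewrite mem_undup mem_cat zs.
have rt : {subset r <= t} by move=> z zr; rewrite mem_undup mem_cat zr orbT.
have ut : uniq t := undup_uniq _.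
have := sum_count_mem _ _ _ ut st; have := sum_count_mem _ _ _ ut rt.
(* Each distinct root of q contributes one more to q than to q'. *)
have -> : (\sum_(z <- t) count_mem z s =
           \sum_(z <- t | root q z) count_mem z r + size (undup s))%N.
  rewrite (bigID (root q)) /= [X in (_ + X)%N]big1 ?addn0; last first.
    by move=> z; rewrite rootq => /count_memPn.
  have -> : size (undup s) = (\sum_(z <- t | root q z) 1)%N.
    rewrite sum1_count -size_filter; apply/perm_size/uniq_perm.
    - exact: undup_uniq.
    - exact: filter_uniq.
    move=> z; rewrite mem_filter mem_undup rootq.
    by case: (boolP (z \in s)) => // /st ->.
  rewrite -big_split; apply: eq_bigr => z qz /=.
  by rewrite addn1 -mu -mup_deriv// mu_prod_XsubC.
rewrite (bigID (root q)) /= => Er Es.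
under eq_bigr do rewrite mu.
(* With A and B the sums of multiplicities in q' over the roots and the non-roots of q, A +
   [size (undup s)] = [size s] = A + B + 1; cancel A. *)
by move: Es; rewrite -szr -Er -addnS => /addnI ->.
Qed.

Lemma score_num_deriv (R : realType) (n : nat) (x y : 'I_n -> R) :
  score_num x y = (score_den x y)^`().
Proof.
rewrite /score_den deriv_prod_uniq ?index_enum_uniq//.
by apply: eq_bigr => i _; rewrite derivD derivX derivC addr0 mul1r.
Qed.

Lemma ml_degreeE (R : realType) (n : nat) (x y : 'I_n -> R) : (0 < n)%N ->
  ml_degree x y = (size (undup (codom (fgm_c x y)))).-1.
Proof.
move=> n0; set s := [seq - (c%:C)%C | c <- codom (fgm_c x y)].
have denE : score_den x y = \prod_(a <- s) ('X - a%:P).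
  rewrite big_map big_image /=.
  by apply: eq_bigr => i _; rewrite polyCN opprK.
have s_gt0 : (0 < size s)%N by rewrite size_map size_codom card_ord.
(* The roots of k are the -c_i, and negation and the embedding into the complex numbers are
   injective, so distinct values stay distinct. *)
have -> : size (undup (codom (fgm_c x y))) = size (undup s).
  have inj : injective (fun c : R => - (c%:C)%C).
    by move=> a b /oppr_inj; exact: (fmorph_inj (real_complex R)).
  by rewrite /s (undup_map_inj inj) size_map.
have [t [ut tr <-]] := sum_mup_deriv_prod_XsubC _ _ s_gt0.
rewrite -denE -score_num_deriv -[RHS]big_filter.
(* Entries of the list that are not solutions contribute 0: being non-roots of k, they are not roots
   of h either. *)
apply: fsbig_fwiden.
- move=> z /= [zn zd]; rewrite mem_filter zd; apply: tr.
  by rewrite -denE -score_num_deriv.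
- exact: filter_uniq.
- move=> z /= []; rewrite mem_filter => /andP[zd _] zs.
  by apply/mupNroot/negP => zn; apply: zs.
Qed.

Theorem theorem2p3 (R : realType) (n : nat) (n_gt0 : (0 < n)%N)
    (theta : R) (theta_bound : -1 <= theta <= 1)
    (x y : 'I_n -> R)
    (sample : forall i : 'I_n, fgm_support theta (x i, y i))
    (weight_neq0 : forall i : 'I_n, fgm_weight (x i) (y i) != 0)
    (p : nat) (d : 'I_p -> R) (mult : 'I_p -> nat)
    (d_inj : injective d)
    (d_values : forall v : R,
       (exists j : 'I_p, d j = v) <-> (exists i : 'I_n, fgm_c x y i = v))
    (multE : forall j : 'I_p,
       mult j = #|[set i : 'I_n | fgm_c x y i == d j]|)
    (l m : nat)
    (lE : l = #|[set j : 'I_p | (1 < mult j)%N]|)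
    (mE : m = (\sum_(j < p | (1 < mult j)%N) mult j)%N)
    (not_all_equal : ~ (l = 1%N /\ m = n)) :
  (ml_degree x y)%:Z = n%:Z + l%:Z - m%:Z - 1.
Proof.
have codom_d : codom d =i codom (fgm_c x y).
  move=> v; apply/codomP/codomP => -[i ->].
    by have [|j <-] := (d_values (d i)).1; [exists i | exists j].
  by have [|j <-] := (d_values (fgm_c x y i)).2; [exists i | exists j].
have ud : uniq (codom d) by apply/injectiveP.
have pE : size (undup (codom (fgm_c x y))) = p.
  rewrite -[RHS](card_ord p) -(size_codom d); apply/perm_size/uniq_perm => //.
    exact: undup_uniq.
  by move=> v; rewrite mem_undup codom_d.
have multC j : mult j = count_mem (d j) (codom (fgm_c x y)).
  by rewrite multE -sum1_card -sum1_count big_image_cond; apply: eq_bigl => i;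
    rewrite inE.
have mult_gt0 j : (0 < mult j)%N.
  by rewrite multC -has_count has_pred1 -codom_d codom_f.
have sum_mult : (\sum_(j < p) mult j = n)%N.
  rewrite -[RHS]card_ord -(size_codom (fgm_c x y)) -(sum_count_mem _ _ _ ud).
    by rewrite big_image /=; apply: eq_bigr => j _.
  by move=> v; rewrite codom_d.
(* Needed for the truncated [p.-1] to agree with the integer p - 1. *)
have p_gt0 : (0 < p)%N.
  by case: (posnP p) (sum_mult) => // p0; rewrite big1 => [|[j]]; lia.
(* Multiplicities are positive, so those not above 1 equal 1; their sum n - m is thus their number p
   - l. *)
have n_split : (n + l = m + p)%N.
  have cardp : (p = l + \sum_(j < p | ~~ (1 < mult j)) 1)%N.
    rewrite lE cardsE -sum1_card -[LHS](card_ord p) -sum1_card.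
    exact: (bigID (fun j => (1 < mult j)%N)).
  have -> : (n = m + \sum_(j < p | ~~ (1 < mult j)) 1)%N.
    rewrite mE -sum_mult (bigID (fun j => (1 < mult j)%N)) /=; congr (_ + _)%N.
    by apply: eq_bigr => j; have := mult_gt0 j; lia.
  lia.
rewrite ml_degreeE// pE; lia.
Qed.
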